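(* Let $N,M\in\mathbb{N}$ be such that $\lambda:=M/N\ge 2$. Let $\Phi=\mathrm{STF}(N,M)$ be the spectral tetris FUNTF of $M$ vectors in $\mathbb{R}^N$ associated with $\lambda$. Then either $\Phi$ is prime, or $\Phi$ factors as $$\Phi=\Phi_1\cup\bigcup_{l=1}^{L}E_N$$ for some $L\in\mathbb{N}$, where $\Phi_1$ is a prime FUNTF of $M-LN$ vectors and $E_N=\{e_j\}_{j=1}^N$ is the standard orthonormal basis for $\mathbb{R}^N$. Moreover, $\Phi$ is divisible if and only if $$j\lambda-\lfloor (j-1)\lambda\rfloor\ge 3\qquad\text{for all integers } j \text{ with } 1<j<\frac{N}{\gcd(N,M)}.$$ In particular, $\Phi$ is divisible if $\lambda\ge 3-\frac1N$, i.e., if $M\ge 3N-1$.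
   Context: A finite collection $\{\varphi_i\}_{i=1}^M\subset\mathbb{R}^N$ is a tight frame for $\mathbb{R}^N$ if there is $A>0$ with $\sum_i|\langle x,\varphi_i\rangle|^2=A\|x\|^2$ for all $x$. It is a FUNTF if moreover all $\|\varphi_i\|=1$. Frames are non-ordered collections with repetition allowed; sub-collections correspond to subsets of the index set, and unions are unions of collections (counting repetitions). A tight frame is prime if no proper sub-collection is a tight frame for $\mathbb{R}^N$, and divisible otherwise. Spectral tetris construction. Let $\lambda=M/N\ge 2$ and $K=\{\,nN/\gcd(N,M): n=0,1,\dots,\gcd(N,M)\,\}$. Define recursively, for $j=1,\dots,N$, the unique numbers $m_j\in\mathbb{N}_0$ and $r_j\in[0,1)$ such that $$\lambda=m_j+r_j\ \text{ if } j-1\in K,\qquad \lambda=(2-r_{j-1})+m_j+r_j\ \text{ otherwise}$$ (then $r_j=0$ exactly when $j\in K$). Put $a_j=\sqrt{r_j/2}$ and $b_j=\sqrt{1-r_j/2}$. Then $\mathrm{STF}(N,M)$ is the collection of $M$ vectors in $\mathbb{R}^N$ consisting of $m_j$ copies of $e_j$ for each $j=1,\dots,N$, together with the two vectors $a_je_j+b_je_{j+1}$ and $a_je_j-b_je_{j+1}$ for each $j\in\{1,\dots,N-1\}\setminus K$, where $e_1,\dots,e_N$ is the standard basis of $\mathbb{R}^N$. It is a FUNTF for $\mathbb{R}^N$. *)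

(* Defs.v *)
From HB Require Import structures.
From mathcomp Require Import all_boot all_order all_algebra.
From mathcomp Require Import reals.
Set Implicit Arguments.
Unset Strict Implicit.
Unset Printing Implicit Defensive.
Import Order.TTheory GRing.Theory Num.Theory.
Local Open Scope ring_scope.

(* A finite collection of vectors (unordered, repetitions allowed) is a
   sequence considered up to perm_eq; the union of collections is ++. *)

Definition dotp (R : realType) (N : nat) (x y : 'rV[R]_N) : R :=
  \sum_(k < N) x 0 k * y 0 k.

(* Euclidean norm; the norm `|x| that MathComp-Analysis puts on row vectors
   is the max norm. *)
Definition norm2 (R : realType) (N : nat) (x : 'rV[R]_N) : R :=
  Num.sqrt (dotp x x).

Definition tight_frame (R : realType) (N : nat) (Phi : seq 'rV[R]_N) : Prop :=
  exists2 A : R, 0 < A &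
    forall x : 'rV[R]_N,
      \sum_(phi <- Phi) `|dotp x phi| ^+ 2 = A * norm2 x ^+ 2.

Definition FUNTF (R : realType) (N : nat) (Phi : seq 'rV[R]_N) : Prop :=
  tight_frame Phi /\ (forall phi, phi \in Phi -> norm2 phi = 1).

Definition subcollection (R : realType) (N : nat) (Phi : seq 'rV[R]_N)
    (J : {set 'I_(size Phi)}) : seq 'rV[R]_N :=
  [seq Phi`_i | i : 'I_(size Phi) in J].

Definition prime_frame (R : realType) (N : nat) (Phi : seq 'rV[R]_N) : Prop :=
  tight_frame Phi /\
  ~ (exists2 J : {set 'I_(size Phi)},
       J \proper [set: 'I_(size Phi)] & tight_frame (subcollection J)).

Definition divisible_frame (R : realType) (N : nat) (Phi : seq 'rV[R]_N) :
    Prop :=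
  tight_frame Phi /\
  (exists2 J : {set 'I_(size Phi)},
     J \proper [set: 'I_(size Phi)] & tight_frame (subcollection J)).

(* The index j of basis vectors and of the spectral tetris data ranges over
   1, ..., N, whereas coordinates are indexed by 'I_N = {0, ..., N-1}. *)
Definition stdvec (R : realType) (N j : nat) : 'rV[R]_N :=
  \row_(k < N) (k.+1 == j)%:R.

Definition stdbasis (R : realType) (N : nat) : seq 'rV[R]_N :=
  [seq stdvec R N j | j <- iota 1 N].

Definition stfK (N M : nat) : seq nat :=
  [seq (n * N %/ gcdn N M)%N | n <- iota 0 (gcdn N M).+1].

(* What is left of lambda in row i.+1, given r = r_i; it is to be split as
   m_(i.+1) + r_(i.+1). *)
Definition stf_rest (R : realType) (N M i : nat) (r : R) : R :=
  if i \in stfK N M then M%:R / N%:R else M%:R / N%:R - (2 - r).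

(* The value at 0 is a dummy: it is never used because 0 \in stfK N M. *)
Fixpoint stf_r (R : realType) (N M j : nat) : R :=
  if j is i.+1 then
    let t := stf_rest N M i (stf_r R N M i) in t - (Num.truncn t)%:R
  else 0.

Definition stf_m (R : realType) (N M j : nat) : nat :=
  Num.truncn (stf_rest N M j.-1 (stf_r R N M j.-1)).

(* The recursive specification of the pairs (m_j, r_j). *)
Definition stf_spec (R : realType) (N M : nat) (m : nat -> nat) (r : nat -> R) :
    Prop :=
  forall j : nat, (1 <= j <= N)%N ->
    0 <= r j < 1 /\
    (if j.-1 \in stfK N M then M%:R / N%:R = (m j)%:R + r j
     else M%:R / N%:R = (2 - r j.-1) + (m j)%:R + r j).

Definition stf_a (R : realType) (N M j : nat) : R :=
  Num.sqrt (stf_r R N M j / 2).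

Definition stf_b (R : realType) (N M j : nat) : R :=
  Num.sqrt (1 - stf_r R N M j / 2).

Definition STF (R : realType) (N M : nat) : seq 'rV[R]_N :=
  flatten [seq nseq (stf_m R N M j) (stdvec R N j) | j <- iota 1 N] ++
  flatten [seq [:: stf_a R N M j *: stdvec R N j
                     + stf_b R N M j *: stdvec R N j.+1;
                   stf_a R N M j *: stdvec R N j
                     - stf_b R N M j *: stdvec R N j.+1]
          | j <- iota 1 N.-1 & j \notin stfK N M].

(* stf_m and stf_r are the unique solution of the specification. *)

Lemma mem0_stfK (N M : nat) : 0%N \in stfK N M.
Proof. by rewrite /stfK /= mul0n div0n inE eqxx. Qed.

Lemma stf_r_ge0 (R : realType) (N M j : nat) :
  2 <= M%:R / N%:R :> R -> 0 <= stf_r R N M j.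
Proof.
move=> h; elim: j => [|i IH] //=.
rewrite subr_ge0 truncn_le // /stf_rest; case: ifP => _.
  by apply: le_trans h.
by rewrite opprB addrA subr_ge0 (le_trans h) // lerDl.
Qed.

Lemma stf_rest_ge0 (R : realType) (N M j : nat) :
  2 <= M%:R / N%:R :> R -> 0 <= stf_rest N M j (stf_r R N M j).
Proof.
move=> h; rewrite /stf_rest; case: ifP => _; first exact: le_trans h.
by rewrite opprB addrA subr_ge0 (le_trans h) // lerDl stf_r_ge0.
Qed.

Lemma stfP (R : realType) (N M : nat) :
  2 <= M%:R / N%:R :> R -> stf_spec N M (stf_m R N M) (stf_r R N M).
Proof.
move=> h [|i] // _; have t0 := stf_rest_ge0 i h.
have /andP[t1 t2] := truncn_itv t0; split.
  by rewrite /= subr_ge0 t1 /= ltrBlDl -natr1 in t2 *.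
rewrite /stf_m /=; set t := stf_rest _ _ _ _.
have tE : (Num.truncn t)%:R + (t - (Num.truncn t)%:R) = t by rewrite addrC subrK.
case: ifP => iK; first by rewrite tE /t /stf_rest iK.
by rewrite -addrA tE /t /stf_rest iK addrC subrK.
Qed.

Lemma stf_unique (R : realType) (N M : nat) (m : nat -> nat) (r : nat -> R) :
  2 <= M%:R / N%:R :> R -> stf_spec N M m r ->
  forall j, (1 <= j <= N)%N -> m j = stf_m R N M j /\ r j = stf_r R N M j.
Proof.
move=> h hs; elim=> [|i IH] // hi.
have [/andP[r0 r1] he] := hs _ hi.
have ht : stf_rest N M i (stf_r R N M i) = (m i.+1)%:R + r i.+1.
  move: he; rewrite /stf_rest /=; case: ifP => // iK he.
  have [|_ <-] := IH.
    by case: i iK hi {IH he r0 r1} => [|i _ /ltnW //]; rewrite mem0_stfK.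
  by rewrite he -[_ + _ + r i.+1]addrA addrC addrK.
have hm : m i.+1 = stf_m R N M i.+1.
  rewrite /stf_m /= ht; apply/esym/truncn_def.
  by rewrite lerDl r0 -natr1 ltrD2l.
by split=> //; rewrite /= -/(stf_m R N M i.+1) -hm ht addrC addKr.
Qed.

(* Main.v *)
Require Import Defs.
From HB Require Import structures.
From mathcomp Require Import all_boot all_order all_algebra.
From mathcomp Require Import reals.
From mathcomp Require Import zify ring lra.
Set Implicit Arguments.
Unset Strict Implicit.
Unset Printing Implicit Defensive.
Import Order.TTheory GRing.Theory Num.Theory.
Local Open Scope ring_scope.

(* The rows [1, ..., j] of the spectral tetris have total weight [j lambda], so
   [r_j] is the fractional part of [j lambda] and [m_j] is the increment of
   [floor (j lambda)], minus [2] unless [j - 1] lies in [K].  The frame operator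
   of a subcollection is tridiagonal: tightness with constant [A] forces each
   pair to be taken or omitted as a whole, and all diagonal entries to be [A].
   Reading the diagonal modulo integers row by row, either [A] is an integer and
   no pair is taken, or [A - lambda] is an integer and all pairs are taken.  In
   the first case each [e_j] is taken [A > 0] times, in the second one each [e_j]
   is omitted [lambda - A] times.  Hence a proper tight subcollection exists if
   and only if all [m_j > 0], and removing [min m_j] copies of the standard basis
   ([lambda - 1] copies when [lambda] is an integer) leaves a prime frame. *)

(** * Subcollections as subsequences *)

Lemma subcollectionE (R : realType) (N : nat) (Phi : seq 'rV[R]_N)
    (J : {set 'I_(size Phi)}) :
  subcollection J = mask [seq i \in J | i <- enum 'I_(size Phi)] Phi.
Proof.
rewrite /subcollection /image_mem.
have -> : enum (mem J) = filter (mem J) (enum 'I_(size Phi)).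
  by rewrite [in RHS]enumT.
rewrite filter_mask map_mask; congr mask.
apply: (@eq_from_nth _ 0); first by rewrite size_map size_enum_ord.
move=> i; rewrite size_map size_enum_ord => hi.
by rewrite (nth_map (Ordinal hi)) ?size_enum_ord // nth_enum_ord.
Qed.

(** Trades index sets for subsequences, which are easier to decompose: the choice among equal
    vectors is forgotten, and properness becomes a drop in size. *)
Lemma proper_tightP (R : realType) (N : nat) (Phi : seq 'rV[R]_N) :
  (exists2 J : {set 'I_(size Phi)},
     J \proper [set: 'I_(size Phi)] & tight_frame (subcollection J)) <->
  (exists S, [/\ subseq S Phi, (size S < size Phi)%N & tight_frame S]).
Proof.
split=> [[J pJ tJ]|[S [/subseqP[b sb ->] sS tS]]].
  exists (subcollection J); split=> //.
    by rewrite subcollectionE mask_subseq.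
  by have := proper_card pJ; rewrite cardsT card_ord /subcollection size_image.
pose J := [set i : 'I_(size Phi) | nth false b i].
have EJ : subcollection J = mask b Phi.
  rewrite subcollectionE; congr mask.
  apply: (@eq_from_nth _ false); first by rewrite size_map size_enum_ord.
  move=> i; rewrite size_map size_enum_ord => hi.
  by rewrite (nth_map (Ordinal hi)) ?size_enum_ord // inE nth_enum_ord.
exists J; last by rewrite EJ.
rewrite properEcard subsetT cardsT card_ord.
by rewrite -(size_image (fun i : 'I_(size Phi) => Phi`_i)) -/(subcollection J) EJ.
Qed.

(** Uniqueness of [s] allows the parts kept in the successive blocks to be recorded by one function
    of the label. *)
Lemma subseq_flatten_map (T S : eqType) (F : T -> seq S) (s : seq T) (u : seq S) :
  uniq s -> subseq u (flatten [seq F j | j <- s]) ->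
  exists2 G : T -> seq S, (forall j, j \in s -> subseq (G j) (F j)) &
    u = flatten [seq G j | j <- s].
Proof.
elim: s u => [|i s IH] u /=.
  by move=> _ /eqP ->; exists (fun=> [::]).
case/andP=> nis us /subseqP[b sb ->].
rewrite -(cat_take_drop (size (F i)) b) mask_cat; last first.
  by rewrite size_takel // sb size_cat leq_addr.
have [|G HG EG] := IH (mask (drop (size (F i)) b) (flatten [seq F j | j <- s])) us.
  exact: mask_subseq.
exists (fun j => if j == i then mask (take (size (F i)) b) (F i) else G j).
  move=> j; rewrite inE; case: eqP => [->|_] /=; first by rewrite mask_subseq.
  exact: HG.
rewrite eqxx EG; congr (_ ++ flatten _); apply/eq_in_map => j js.
by case: eqP js nis => // -> ->.
Qed.

Lemma subseq_nseq (T : eqType) (n : nat) (x : T) (u : seq T) :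
  subseq u (nseq n x) -> u = nseq (size u) x /\ (size u <= n)%N.
Proof.
move=> h; split; last by have := size_subseq h; rewrite size_nseq.
by apply/all_pred1P/allP=> y /(mem_subseq h); rewrite mem_nseq /= => /andP[].
Qed.

(** * Subcollections of a spectral tetris *)

Definition tetris_pair (R : realType) (N M j : nat) : seq 'rV[R]_N :=
  [:: stf_a R N M j *: stdvec R N j + stf_b R N M j *: stdvec R N j.+1;
      stf_a R N M j *: stdvec R N j - stf_b R N M j *: stdvec R N j.+1].

(* The subcollections of a spectral tetris frame: [k j] copies of [e_j], and
   the [+] (resp. [-]) vector of the [j]-th pair when [c j] (resp. [d j]). *)
Definition tetris (R : realType) (N M : nat) (k : nat -> nat)
    (c d : nat -> bool) : seq 'rV[R]_N :=
  flatten [seq nseq (k j) (stdvec R N j) | j <- iota 1 N] ++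
  flatten [seq mask [:: c j; d j] (tetris_pair R N M j)
          | j <- iota 1 N.-1 & j \notin stfK N M].

Lemma STF_tetris (R : realType) (N M : nat) :
  STF R N M = tetris R N M (stf_m R N M) xpredT xpredT.
Proof. by []. Qed.

(** The parameters [k'], [c], [d] capture every subcollection, so tightness becomes a condition on
    them alone. *)
Lemma subseq_tetris (R : realType) (N M : nat) (k : nat -> nat)
    (u : seq 'rV[R]_N) :
  subseq u (tetris R N M k xpredT xpredT) ->
  exists k' c d, (forall j, (1 <= j <= N)%N -> (k' j <= k j)%N) /\
    u = tetris R N M k' c d.
Proof.
case/subseqP=> b sb ->; rewrite /tetris.
set A := flatten _; set B := flatten _.
rewrite -(cat_take_drop (size A) b) mask_cat; last first.
  by rewrite size_takel // sb size_cat leq_addr.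
have [|G1 H1 ->] := subseq_flatten_map _ (mask_subseq (take (size A) b) A).
  exact: iota_uniq.
have [|G2 H2 ->] := subseq_flatten_map _ (mask_subseq (drop (size A) b) B).
  by rewrite filter_uniq // iota_uniq.
have mask2 j : j \in [seq j <- iota 1 N.-1 | j \notin stfK N M] ->
    exists cd : bool * bool, G2 j == mask [:: cd.1; cd.2] (tetris_pair R N M j).
  move=> /H2/subseqP[[|c [|d [|]]] // _ ->].
  by exists (c, d).
(* Choosing the two bits needs a proof that [j] indexes a pair; elsewhere the default [(true, true)]
   is never read. *)
pose cd j := if @idP (j \in [seq j <- iota 1 N.-1 | j \notin stfK N M])
  is ReflectT h then xchoose (mask2 j h) else (true, true).
exists (size \o G1), (fst \o cd), (snd \o cd); split.
  move=> j hj; have [|_ //] := @subseq_nseq _ (k j) (stdvec R N j) (G1 j).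
  by apply: H1; rewrite mem_iota add1n ltnS.
congr (flatten _ ++ flatten _); apply/eq_in_map => j hj.
  by have [] := subseq_nseq (H1 _ hj).
rewrite /cd /=; case: {-}_ / idP => // h; exact/eqP/(xchooseP (mask2 j h)).
Qed.

(** * Inner products with the standard basis *)

Lemma dotpDr (R : realType) (N : nat) (x y z : 'rV[R]_N) :
  dotp x (y + z) = dotp x y + dotp x z.
Proof. by rewrite /dotp -big_split; apply: eq_bigr => i _; rewrite mxE mulrDr. Qed.

Lemma dotpZr (R : realType) (N : nat) (a : R) (x y : 'rV[R]_N) :
  dotp x (a *: y) = a * dotp x y.
Proof. by rewrite /dotp mulr_sumr; apply: eq_bigr => i _; rewrite mxE mulrCA. Qed.

Lemma dotpNr (R : realType) (N : nat) (x y : 'rV[R]_N) : dotp x (- y) = - dotp x y.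
Proof. by rewrite -scaleN1r dotpZr mulN1r. Qed.

Lemma dotpC (R : realType) (N : nat) (x y : 'rV[R]_N) : dotp x y = dotp y x.
Proof. by apply: eq_bigr => i _; rewrite mulrC. Qed.

Lemma dotp_stdvec (R : realType) (N : nat) (x : 'rV[R]_N) (i : 'I_N) :
  dotp x (stdvec R N i.+1) = x 0 i.
Proof.
rewrite /dotp (bigD1 i) //= mxE eqxx mulr1 big1 ?addr0 // => k nk.
by rewrite mxE eqSS (inj_eq val_inj) (negPf nk) mulr0.
Qed.

Lemma dotp_stdvec2 (R : realType) (N i j : nat) : (1 <= i <= N)%N ->
  dotp (stdvec R N i) (stdvec R N j) = (i == j)%:R.
Proof.
case: i => // i hi; rewrite dotpC (dotp_stdvec _ (Ordinal hi)) mxE /=.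
by [].
Qed.

Lemma norm2_sqr (R : realType) (N : nat) (x : 'rV[R]_N) : norm2 x ^+ 2 = dotp x x.
Proof. by rewrite sqr_sqrtr // sumr_ge0 // => i _; rewrite -expr2 sqr_ge0. Qed.

Lemma norm2_stdvec_sum (R : realType) (N : nat) (x : 'rV[R]_N) :
  norm2 x ^+ 2 = \sum_(1 <= j < N.+1) dotp x (stdvec R N j) ^+ 2.
Proof.
rewrite norm2_sqr big_add1 big_mkord; apply: eq_bigr => i _.
by rewrite dotp_stdvec expr2.
Qed.

(** * The set [K] and the closed form of the spectral tetris data *)

Lemma dvdn_mul_gcd (N M j : nat) : (0 < N)%N ->
  (N %| j * M)%N = (N %/ gcdn N M %| j)%N.
Proof.
move=> hN; have g0 : (0 < gcdn N M)%N by rewrite gcdn_gt0 hN.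
have EN : (N = N %/ gcdn N M * gcdn N M)%N by rewrite divnK // dvdn_gcdl.
have EM : (M = M %/ gcdn N M * gcdn N M)%N by rewrite divnK // dvdn_gcdr.
have cop : coprime (N %/ gcdn N M) (M %/ gcdn N M).
  by rewrite /coprime -(eqn_pmul2r g0) muln_gcdl -EN -EM mul1n.
have -> : (j * M = j * (M %/ gcdn N M) * gcdn N M)%N by rewrite -mulnA -EM.
by rewrite {1}EN dvdn_pmul2r // Gauss_dvdl.
Qed.

(** The divisibility says that [j * lambda] is an integer, so [K] marks the rows where the running
    weight has no fractional part. *)
Lemma mem_stfK (N M j : nat) : (0 < N)%N -> (j <= N)%N ->
  (j \in stfK N M) = (N %| j * M)%N.
Proof.
move=> hN hj; have g0 : (0 < gcdn N M)%N by rewrite gcdn_gt0 hN.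
have EN : (N %/ gcdn N M * gcdn N M = N)%N by rewrite divnK // dvdn_gcdl.
have q0 : (0 < N %/ gcdn N M)%N by rewrite divn_gt0 // dvdn_leq // dvdn_gcdl.
rewrite dvdn_mul_gcd //; apply/mapP/dvdnP => [[n _ ->]|[n En]]; exists n.
- by rewrite muln_divA ?dvdn_gcdl.
- by rewrite mem_iota /= add0n ltnS -(leq_pmul2r q0) -En mulnC EN.
- by rewrite En muln_divA ?dvdn_gcdl.
Qed.

Lemma natr_divn (R : realType) (N a : nat) : (0 < N)%N ->
  a%:R / N%:R = (a %/ N)%:R + (a %% N)%:R / N%:R :> R.
Proof.
move=> hN; have n0 : N%:R != 0 :> R by rewrite pnatr_eq0 -lt0n.
by rewrite {1}(divn_eq a N) natrD natrM mulrDl mulfK.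
Qed.

Lemma ratio_ge2 (R : realType) (N M : nat) : (0 < N)%N ->
  (2 <= M%:R / N%:R :> R) = (2 * N <= M)%N.
Proof. by move=> hN; rewrite ler_pdivlMr ?ltr0n // -natrM ler_nat. Qed.

(* Since the rows [1, ..., j] carry total weight [j lambda], of which all but
   the first share of the [j]-th pair is integral, [r_j] is the fractional part
   of [j lambda]. *)
Lemma stf_closed_form (R : realType) (N M j : nat) : (0 < N)%N ->
    2 <= M%:R / N%:R :> R -> (j < N)%N ->
  stf_r R N M j.+1 = (j.+1 * M %% N)%:R / N%:R /\
  (stf_m R N M j.+1 + 2 * (j \notin stfK N M) + j * M %/ N = j.+1 * M %/ N)%N.
Proof.
move=> hN h2 hj; have M2N := h2; rewrite ratio_ge2 // in M2N.
have n0 : N%:R != 0 :> R by rewrite pnatr_eq0 -lt0n.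
(* Candidates read off from the floors of [i * lambda]; once they satisfy the recursion,
   [stf_unique] identifies them. *)
pose m i := (i * M %/ N - i.-1 * M %/ N - 2 * (i.-1 \notin stfK N M))%N.
pose r i : R := (i * M %% N)%:R / N%:R.
(* As [lambda >= 2], the floors grow by at least [2] per row, so the truncated subtractions in [m]
   are exact. *)
have le_fl i : (i * M %/ N + 2 <= i.+1 * M %/ N)%N.
  by rewrite leq_divRL // mulnDl mulSn addnC leq_add // leq_trunc_div.
have mE i : (m i.+1 + 2 * (i \notin stfK N M) + i * M %/ N = i.+1 * M %/ N)%N.
  by rewrite /m /=; have := le_fl i; case: (_ \notin _); lia.
have spec : stf_spec N M m r.
  case=> // i hi; split.
    by rewrite /r divr_ge0 // ltr_pdivrMr ?ltr0n // mul1r ltr_nat ltn_pmod.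
  have E := natr_divn R (i.+1 * M) hN; have E' := natr_divn R (i * M) hN.
  have Er : (i.+1 * M)%:R / N%:R = M%:R / N%:R + (i * M)%:R / N%:R :> R.
    by rewrite mulSn natrD mulrDl.
  have := mE i; move/(congr1 (fun a => a%:R : R)); rewrite !natrD.
  rewrite [i.+1.-1]/= /r; case: ifP => iK; rewrite ?iK /=.
    move: E'; have -> : (i * M %% N = 0)%N.
      by apply/eqP; move: iK; rewrite mem_stfK // ltnW //; case/andP: hi.
    by rewrite mul0r; lra.
  lra.
by have [/esym -> /esym ->] := stf_unique h2 spec (j := j.+1) hj.
Qed.

Lemma stf_rE (R : realType) (N M j : nat) : (0 < N)%N ->
    2 <= M%:R / N%:R :> R -> (j <= N)%N ->
  stf_r R N M j = (j * M %% N)%:R / N%:R.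
Proof.
move=> hN h2; case: j => [|j] hj; first by rewrite mul0n mod0n mul0r.
by have [] := stf_closed_form hN h2 hj.
Qed.

Lemma stf_r_eq0 (R : realType) (N M j : nat) : (0 < N)%N ->
    2 <= M%:R / N%:R :> R -> (j <= N)%N ->
  (stf_r R N M j == 0) = (j \in stfK N M).
Proof.
move=> hN h2 hj; rewrite stf_rE // mem_stfK // mulf_eq0 invr_eq0 !pnatr_eq0.
by rewrite (gtn_eqF hN) orbF.
Qed.

Lemma stf_r_lt1 (R : realType) (N M j : nat) : (0 < N)%N ->
    2 <= M%:R / N%:R :> R -> (j <= N)%N -> stf_r R N M j < 1.
Proof.
move=> hN h2 hj; rewrite stf_rE //.
by rewrite ltr_pdivrMr ?ltr0n // mul1r ltr_nat ltn_pmod.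
Qed.

Lemma sqr_stf_a (R : realType) (N M j : nat) : 2 <= M%:R / N%:R :> R ->
  stf_a R N M j ^+ 2 = stf_r R N M j / 2.
Proof. by move=> h2; rewrite sqr_sqrtr // divr_ge0 // stf_r_ge0. Qed.

Lemma sqr_stf_b (R : realType) (N M j : nat) : (0 < N)%N ->
    2 <= M%:R / N%:R :> R -> (j <= N)%N ->
  stf_b R N M j ^+ 2 = 1 - stf_r R N M j / 2.
Proof. by move=> hN h2 hj; rewrite sqr_sqrtr //; have := stf_r_lt1 hN h2 hj; lra. Qed.

(** * The frame operator of a subcollection *)

Definition pair_cnt (N M : nat) (c d : nat -> bool) (j : nat) : nat :=
  if j \in stfK N M then 0 else (c j + d j)%N.

(** The [(j, j)] entry of the frame operator; the last term comes from the second coordinates of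
    pair [j - 1]. *)
Definition tetris_diag (R : realType) (N M : nat) (k : nat -> nat)
    (c d : nat -> bool) (j : nat) : R :=
  (k j)%:R + (pair_cnt N M c d j)%:R * (stf_r R N M j / 2) +
  (pair_cnt N M c d j.-1)%:R * (1 - stf_r R N M j.-1 / 2).

(** The [(j, j + 1)] entry of the frame operator, to which the two vectors of a pair contribute with
    opposite signs. *)
Definition tetris_offdiag (R : realType) (N M : nat) (c d : nat -> bool)
    (j : nat) : R :=
  if j \in stfK N M then 0
  else ((c j)%:R - (d j)%:R) * (stf_a R N M j * stf_b R N M j).

Lemma tetris_sum (R : realType) (N M : nat) (k : nat -> nat)
    (c d : nat -> bool) (x : 'rV[R]_N) :
    (0 < N)%N -> 2 <= M%:R / N%:R :> R ->
  \sum_(phi <- tetris R N M k c d) `|dotp x phi| ^+ 2 =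
  \sum_(1 <= j < N.+1)
    (tetris_diag R N M k c d j * dotp x (stdvec R N j) ^+ 2 +
     tetris_offdiag R N M c d j *
       (2 * dotp x (stdvec R N j) * dotp x (stdvec R N j.+1))).
Proof.
move=> hN h2; pose y j := dotp x (stdvec R N j).
have NK : N \in stfK N M by rewrite mem_stfK // dvdn_mulr.
(* Pair [j] feeds row [j + 1] through [G]; [F] holds its share of row [j] and the cross term. *)
pose G j := (pair_cnt N M c d j)%:R * (1 - stf_r R N M j / 2) * y j.+1 ^+ 2.
pose F j := (pair_cnt N M c d j)%:R * (stf_r R N M j / 2) * y j ^+ 2 +
  tetris_offdiag R N M c d j * (2 * y j * y j.+1).
transitivity (\sum_(1 <= j < N.+1) (k j)%:R * y j ^+ 2 +
              \sum_(1 <= j < N) (F j + G j)).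
  rewrite big_cat !big_flatten !big_map /= big_filter; congr (_ + _).
    rewrite /index_iota subn1 /=; apply: eq_bigr => j _.
    by rewrite big_nseq iter_addr_0 real_normK ?num_real // mulr_natl.
  rewrite /index_iota subn1 big_mkcond; apply: eq_big_seq => j.
  rewrite mem_iota add1n prednK // => /andP[_ hj].
  rewrite /F /G /pair_cnt /tetris_offdiag; case: (j \in _) => /=.
    by rewrite !mul0r !addr0.
  have := sqr_stf_a j h2; have := sqr_stf_b hN h2 (ltnW hj).
  rewrite /tetris_pair; case: (c j); case: (d j) => /= Eb Ea;
  rewrite ?big_cons ?big_nil ?addr0 ?real_normK ?num_real // ?dotpDr ?dotpNr ?dotpZr;
  rewrite -/(y j) -/(y j.+1) -?Eb -?Ea; ring.
(* Both boundary terms vanish since [0] and [N] lie in [K], where there is no pair. *)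
have shift : \sum_(1 <= j < N) (F j + G j) =
    \sum_(1 <= j < N.+1) F j + \sum_(1 <= j < N.+1) G j.-1.
  rewrite big_split /=; congr (_ + _).
    rewrite [RHS]big_nat_recr //= /F /pair_cnt /tetris_offdiag NK.
    by rewrite !mul0r !addr0.
  rewrite [RHS]big_add1 /= [RHS]big_ltn //= {2}/G /pair_cnt mem0_stfK !mul0r add0r.
  by [].
rewrite shift -!big_split; apply: eq_big_nat => -[|j] // hj /=.
rewrite /F /G /tetris_diag -/(y _) -/(y _) /=; ring.
Qed.

Lemma tight_tetris (R : realType) (N M : nat) (k : nat -> nat)
    (c d : nat -> bool) (A : R) :
    (0 < N)%N -> 2 <= M%:R / N%:R :> R -> 0 < A ->
    (forall j, (1 <= j <= N)%N -> tetris_diag R N M k c d j = A) ->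
    (forall j, (1 <= j < N)%N -> tetris_offdiag R N M c d j = 0) ->
  tight_frame (tetris R N M k c d).
Proof.
move=> hN h2 A0 hd ho; exists A => // x.
rewrite tetris_sum // norm2_stdvec_sum mulr_sumr; apply: eq_big_nat => j hj.
rewrite hd //; suff -> : tetris_offdiag R N M c d j = 0 by rewrite mul0r addr0.
case/andP: hj => j1; rewrite ltnS leq_eqVlt => /orP[/eqP ->|jN].
  by rewrite /tetris_offdiag mem_stfK // dvdn_mulr.
by rewrite ho ?j1.
Qed.

Lemma dotpDl (R : realType) (N : nat) (x y z : 'rV[R]_N) :
  dotp (x + y) z = dotp x z + dotp y z.
Proof. by rewrite ![dotp _ z]dotpC dotpDr. Qed.

Lemma sum_nat_delta (R : realType) (N i : nat) (F : nat -> R) :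
  (1 <= i <= N)%N -> \sum_(1 <= j < N.+1) F j * (i == j)%:R = F i.
Proof.
move=> hi; rewrite (bigD1_seq i) ?iota_uniq ?mem_index_iota //= eqxx mulr1.
rewrite big1 ?addr0 // => j; rewrite eq_sym => /negPf ->; exact: mulr0.
Qed.

(** Testing on [e_j] isolates a diagonal entry; testing on [e_j + e_(j+1)], of squared norm [2],
    gives [2 A] plus twice the off-diagonal entry. *)
Lemma tight_tetris_diag (R : realType) (N M : nat) (k : nat -> nat)
    (c d : nat -> bool) :
    (0 < N)%N -> 2 <= M%:R / N%:R :> R ->
    tight_frame (tetris R N M k c d) ->
  exists2 A : R, 0 < A &
    (forall j, (1 <= j <= N)%N -> tetris_diag R N M k c d j = A) /\
    (forall j, (1 <= j < N)%N -> tetris_offdiag R N M c d j = 0).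
Proof.
move=> hN h2 [A A0 hA]; exists A => //.
have hd j : (1 <= j <= N)%N -> tetris_diag R N M k c d j = A.
  move=> hj; have := hA (stdvec R N j); rewrite norm2_sqr tetris_sum //.
  rewrite dotp_stdvec2 // eqxx mulr1 => <-; rewrite -[LHS](sum_nat_delta _ hj).
  apply: eq_big_nat => i _; rewrite !dotp_stdvec2 //.
  case: (eqVneq j i) => [->|_]; last by rewrite /=; ring.
  have -> : (i == i.+1) = false by lia.
  by rewrite /=; ring.
split=> // j /andP[j1 jN]; have hj : (1 <= j <= N)%N by rewrite j1 ltnW.
have hj1 : (1 <= j.+1 <= N)%N by [].
have := hA (stdvec R N j + stdvec R N j.+1); rewrite norm2_sqr tetris_sum //.
have -> : dotp (stdvec R N j + stdvec R N j.+1) (stdvec R N j + stdvec R N j.+1) = 2.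
  rewrite dotpDl !dotpDr !dotp_stdvec2 // !eqxx.
  have -> : (j == j.+1) = false by lia.
  have -> : (j.+1 == j) = false by lia.
  by rewrite /=; ring.
under eq_big_nat => i hi.
  have -> : tetris_diag R N M k c d i * dotp (stdvec R N j + stdvec R N j.+1) (stdvec R N i) ^+ 2 +
     tetris_offdiag R N M c d i * (2 * dotp (stdvec R N j + stdvec R N j.+1) (stdvec R N i) *
        dotp (stdvec R N j + stdvec R N j.+1) (stdvec R N i.+1)) =
     tetris_diag R N M k c d i * (j == i)%:R + tetris_diag R N M k c d i * (j.+1 == i)%:R
     + 2 * tetris_offdiag R N M c d i * (j == i)%:R.
    rewrite !dotpDl !dotp_stdvec2 // eqSS.
    case: (eqVneq j i) => [->|nji].
      have -> : (i == i.+1) = false by lia.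
      have -> : (i.+1 == i) = false by lia.
      by rewrite /=; ring.
    case: (eqVneq j.+1 i) => [<-|_]; last by rewrite /=; ring.
    have -> : (j == j.+2) = false by lia.
    by rewrite /=; ring.
  over.
rewrite !big_split /= !sum_nat_delta // !hd //; lra.
Qed.

(** * Constants of tight subcollections *)

Lemma natr_frac_eq0 (R : realType) (a b : nat) (r : R) :
  a%:R = b%:R + r -> 0 <= r < 1 -> r = 0.
Proof.
move=> E /andP[r0 r1]; suff ab : a = b by move: E; rewrite ab; lra.
have : (b%:R <= a%:R :> R) by rewrite E lerDl.
have : (a%:R < b.+1%:R :> R) by rewrite E -natr1 ltrD2l.
by rewrite ltr_nat ler_nat; lia.
Qed.

(** This is the recursion defining [m_j] and [r_j], read as the weight of row [j]. *)
Lemma tetris_diag_full (R : realType) (N M : nat) (j : nat) : (0 < N)%N ->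
    2 <= M%:R / N%:R :> R -> (1 <= j <= N)%N ->
  tetris_diag R N M (stf_m R N M) xpredT xpredT j = M%:R / N%:R.
Proof.
move=> hN h2 hj; have [_] := stfP h2 hj; rewrite /tetris_diag /pair_cnt.
have [_ jN] := andP hj.
have := stf_r_eq0 hN h2 jN; case: (boolP (j \in _)) => _ /eqP r0;
case: (boolP (j.-1 \in _)) => _ ->; rewrite ?r0 /=; lra.
Qed.

(** Off [K] the product [a_j b_j] is nonzero, so the off-diagonal condition forces [c j = d j]. The
    first pair then selects the alternative, and induction on the rows propagates it: a later change
    would make a nonzero [r_j] an integer. *)
Lemma tight_tetris_pairs (R : realType) (N M : nat) (k : nat -> nat)
    (c d : nat -> bool) :
    (0 < N)%N -> 2 <= M%:R / N%:R :> R ->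
    tight_frame (tetris R N M k c d) ->
  exists2 A : R, 0 < A &
    ((forall j, (1 <= j <= N)%N -> (k j)%:R = A) /\
     (forall j, (1 <= j < N)%N -> j \notin stfK N M -> ~~ c j && ~~ d j)) \/
    ((forall j, (1 <= j <= N)%N ->
       A + (stf_m R N M j)%:R = M%:R / N%:R + (k j)%:R) /\
     (forall j, (1 <= j < N)%N -> j \notin stfK N M -> c j && d j)).
Proof.
move=> hN h2 /(tight_tetris_diag hN h2)[A A0 [hd ho]]; exists A => //.
have NK : N \in stfK N M by rewrite mem_stfK // dvdn_mulr.
have r01 j : (j <= N)%N -> 0 <= stf_r R N M j < 1.
  by move=> jN; rewrite stf_r_ge0 // (stf_r_lt1 hN h2).
have rn0 j : (j <= N)%N -> j \notin stfK N M -> stf_r R N M j != 0.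
  by move=> jN; rewrite (stf_r_eq0 hN h2 jN).
have cd j : (1 <= j <= N)%N -> j \notin stfK N M -> c j = d j.
  case/andP=> j1 jN jK; have {}jN : (j < N)%N.
    by rewrite ltn_neqAle jN andbT; apply: contraNneq jK => ->.
  have := ho j; rewrite j1 jN => /(_ isT); rewrite /tetris_offdiag (negPf jK).
  have a0 : stf_a R N M j != 0.
    by rewrite -sqrf_eq0 sqr_stf_a // mulf_neq0 ?invr_eq0 ?pnatr_eq0 ?rn0 // ltnW.
  have b0 : stf_b R N M j != 0.
    rewrite -sqrf_eq0 sqr_stf_b ?(ltnW jN) //; have := r01 j (ltnW jN); lra.
  move/eqP; rewrite !mulf_eq0 (negPf a0) (negPf b0) !orbF subr_eq0 eqr_nat.
  by case: (c j); case: (d j).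
pose s j := pair_cnt N M c d j.
have hd1 := hd 1%N; have hf1 := @tetris_diag_full R N M 1 hN h2.
(* If [1] is in [K] there is no first pair, the two values coincide, and the first alternative is
   taken. *)
have [sj|sj] : s 1%N = 0%N \/ s 1%N = pair_cnt N M xpredT xpredT 1%N.
- rewrite /s /pair_cnt; case: (boolP (_ \in _)) => K1; first by left.
  by rewrite cd //; case: (d 1%N); [right|left].
- left; have {}hd1 : A = (k 1%N)%:R.
    rewrite -hd1 // /tetris_diag -/(s 1%N) sj /pair_cnt mem0_stfK /=; lra.
  (* Taking pair [j + 1] after omitting pair [j] would give [k_1 = k_(j+1) + r_(j+1)]. *)
  have s0 j : (j <= N)%N -> s j = 0%N.
    elim: j => [|j IH] hj; first by rewrite /s /pair_cnt mem0_stfK.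
    have := hd j.+1 hj; rewrite /tetris_diag; set r := stf_r R N M j.+1; rewrite /= -/(s j) -/(s j.+1) IH 1?ltnW // hd1.
    rewrite /s /pair_cnt; case: (boolP (_ \in _)) => // jK.
    rewrite cd //; case: (d _) => //= E.
    have : r != 0 := rn0 _ hj jK; rewrite (@natr_frac_eq0 R (k 1%N) (k j.+1) r _ (r01 _ hj)).
      by rewrite eqxx.
    rewrite -[(1 + 1)%N]/2%N in E; lra.
  split=> j /andP[j1 jN].
    rewrite -(hd j) ?j1 // /tetris_diag -/(s j) -/(s j.-1) !s0 //; last by lia.
    by lra.
  move=> jK; have := s0 j (ltnW jN); rewrite /s /pair_cnt (negPf jK).
  by case: (c j); case: (d j).
right; have {}hd1 : A + (stf_m R N M 1)%:R = M%:R / N%:R + (k 1%N)%:R.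
  by rewrite -hd1 // -hf1 // /tetris_diag -/(s 1%N) sj /= /pair_cnt mem0_stfK; lra.
(* Dual argument: subtracting row [j + 1] from that of the full frame cancels the share [Z] of pair
   [j], and omitting pair [j + 1] would make [r_(j+1)] an integer. *)
have s1 j : (j <= N)%N -> s j = pair_cnt N M xpredT xpredT j.
  elim: j => [|j IH] hj; first by rewrite /s /pair_cnt mem0_stfK.
  have := hd j.+1 hj; have := tetris_diag_full hN h2 (j := j.+1) hj.
  rewrite /tetris_diag; set r := stf_r R N M j.+1; rewrite /= -/(s j) -/(s j.+1) IH 1?ltnW //.
  set Z := (pair_cnt N M xpredT xpredT j)%:R * _.
  rewrite /s /pair_cnt; case: (boolP (_ \in _)) => // jK.
  rewrite cd //; case: (d _) => //= F E.
  have : r != 0 := rn0 _ hj jK.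
  rewrite (@natr_frac_eq0 R (k j.+1 + stf_m R N M 1) (k 1%N + stf_m R N M j.+1)
    r _ (r01 _ hj)) ?eqxx //.
  by rewrite -[(1 + 1)%N]/2%N in E, F; rewrite !natrD; lra.
split=> j /andP[j1 jN].
  rewrite -(hd j) ?j1 // -(tetris_diag_full hN h2 (j := j)) ?j1 //.
  by rewrite /tetris_diag -/(s j) -/(s j.-1) !s1 //; [lra|lia].
move=> jK; have := s1 j (ltnW jN); rewrite /s /pair_cnt (negPf jK).
by case: (c j); case: (d j).
Qed.

(** * Removal of copies of the standard basis, and primality *)

Lemma eq_tetris (R : realType) (N M : nat) (k k' : nat -> nat)
    (c c' d d' : nat -> bool) :
    (forall j, (1 <= j <= N)%N -> k j = k' j) ->
    (forall j, (1 <= j < N)%N -> j \notin stfK N M -> c j = c' j /\ d j = d' j) ->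
  tetris R N M k c d = tetris R N M k' c' d'.
Proof.
move=> hk hcd; congr (flatten _ ++ flatten _); apply/eq_in_map => j.
  by rewrite mem_iota add1n ltnS => hj; rewrite hk.
rewrite mem_filter mem_iota => /andP[jK /andP[j1 jN]].
by have [|-> ->] := hcd j _ jK; first lia.
Qed.

Lemma subseq_flatten2 (T : Type) (S : eqType) (F G : T -> seq S) (s : seq T) :
  (forall j, subseq (F j) (G j)) ->
  subseq (flatten [seq F j | j <- s]) (flatten [seq G j | j <- s]).
Proof. by move=> h; elim: s => //= j s IH; rewrite cat_subseq. Qed.

Lemma tetris_subseq (R : realType) (N M : nat) (k k' : nat -> nat)
    (c d : nat -> bool) :
    (forall j, (k' j <= k j)%N) ->
  subseq (tetris R N M k' c d) (tetris R N M k c d).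
Proof.
move=> hk; apply: cat_subseq => //; apply: subseq_flatten2 => j.
by rewrite -(subnKC (hk j)) nseqD prefix_subseq.
Qed.

(** The removed vectors are spread over the blocks of equal [e_j], so multiplicities are compared by
    counting. *)
Lemma perm_tetris_basis (R : realType) (N M L : nat) (k k' : nat -> nat)
    (c d : nat -> bool) :
    (forall j, (1 <= j <= N)%N -> (k' j + L)%N = k j) ->
  perm_eq (tetris R N M k c d)
    (tetris R N M k' c d ++ flatten (nseq L (stdbasis R N))).
Proof.
move=> hk; apply/permP => a; rewrite /tetris !count_cat addnAC; congr addn.
rewrite !count_flatten map_nseq sumn_nseq -!map_comp /stdbasis.
rewrite count_map -sumn_count !sumnE !big_map big_distrl -big_split.
apply: eq_big_seq => j; rewrite mem_iota add1n ltnS => hj.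
by rewrite /= !count_nseq -hk // mulnDr.
Qed.

Lemma size_tetris_stf (R : realType) (N M : nat) : (0 < N)%N ->
    2 <= M%:R / N%:R :> R ->
  size (tetris R N M (stf_m R N M) xpredT xpredT) = M.
Proof.
move=> hN h2; rewrite size_cat !size_flatten /shape -!map_comp !sumnE !big_map.
rewrite big_filter.
transitivity (\sum_(1 <= j < N.+1) stf_m R N M j +
  \sum_(1 <= j < N | j \notin stfK N M) 2)%N.
  rewrite /index_iota !subn1; congr addn.
  by apply: eq_bigr => j _ /=; rewrite size_nseq.
have -> : (\sum_(1 <= j < N | j \notin stfK N M) 2 =
    \sum_(0 <= j < N) 2 * (j \notin stfK N M))%N.
  rewrite big_mkcond [RHS]big_ltn // mem0_stfK add0n.
  by apply: eq_bigr => j _; case: ifP.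
rewrite big_add1 -big_split /=.
(* Counting both vectors of pair [j] with row [j + 1] makes each summand an increment of the floor,
   and the sum telescopes to [M]. *)
transitivity (\sum_(0 <= j < N) (j.+1 * M %/ N - j * M %/ N))%N.
  apply: eq_big_nat => j /= hj.
  by have [_ <-] := stf_closed_form hN h2 hj; rewrite addnK.
rewrite telescope_sumn ?mul0n ?div0n ?subn0 ?mulKn // => i j ij.
by rewrite leq_div2r // leq_mul2r ij orbT.
Qed.

Lemma norm2_tetris (R : realType) (N M : nat) (k : nat -> nat)
    (c d : nat -> bool) (phi : 'rV[R]_N) : (0 < N)%N ->
    2 <= M%:R / N%:R :> R ->
  phi \in tetris R N M k c d -> norm2 phi = 1.
Proof.
move=> hN h2 hphi; apply/eqP; rewrite -(@eqrXn2 _ 2) ?sqrtr_ge0 // expr1n norm2_sqr.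
move: hphi; rewrite mem_cat => /orP[] /flattenP[s /mapP[j]].
  rewrite mem_iota add1n ltnS => hj ->; rewrite mem_nseq => /andP[_ /eqP ->].
  by rewrite dotp_stdvec2 // eqxx.
rewrite mem_filter mem_iota add1n prednK // => /andP[_ /andP[j1 jN]] -> /mem_mask.
have hj : (1 <= j <= N)%N by rewrite j1 ltnW.
have hj1 : (1 <= j.+1 <= N)%N by [].
have Ea := sqr_stf_a j h2; have Eb := sqr_stf_b hN h2 (ltnW jN).
have -> : 1 = stf_a R N M j ^+ 2 + stf_b R N M j ^+ 2 :> R by rewrite Ea Eb; lra.
rewrite !inE => /orP[] /eqP ->;
rewrite ?dotpDr ?dotpNr !dotpZr ![dotp (_ + _) _]dotpC;
rewrite ?dotpDr ?dotpNr !dotpZr !dotp_stdvec2 // !eqxx.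
  have -> : (j == j.+1) = false by lia.
  have -> : (j.+1 == j) = false by lia.
  by apply/eqP; rewrite /=; ring.
have -> : (j == j.+1) = false by lia.
have -> : (j.+1 == j) = false by lia.
by apply/eqP; rewrite /=; ring.
Qed.

(** Removing [L] copies of the basis lowers the frame constant from [lambda] to [lambda - L], which
    the bound on [L] keeps positive. *)
Lemma tight_tetris_sub (R : realType) (N M L : nat) (k : nat -> nat) : (0 < N)%N ->
    2 <= M%:R / N%:R :> R -> L%:R < M%:R / N%:R :> R ->
    (forall j, (1 <= j <= N)%N -> (k j + L)%N = stf_m R N M j) ->
  tight_frame (tetris R N M k xpredT xpredT).
Proof.
move=> hN h2 hL hk; apply: (@tight_tetris _ _ _ _ _ _ (M%:R / N%:R - L%:R)) => //.
- by rewrite subr_gt0.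
- move=> j hj; rewrite -(tetris_diag_full hN h2 hj) /tetris_diag -(hk _ hj) natrD.
  lra.
- by move=> j _; rewrite /tetris_offdiag subrr mul0r; case: ifP.
Qed.

(* The second alternative is the case of an integer [lambda], where there are no
   pairs and the collection is the standard basis. *)
Lemma prime_tetris (R : realType) (N M L : nat) (k : nat -> nat) : (0 < N)%N ->
    2 <= M%:R / N%:R :> R -> L%:R < M%:R / N%:R :> R ->
    (forall j, (1 <= j <= N)%N -> (k j + L)%N = stf_m R N M j) ->
    (exists2 j, (1 <= j <= N)%N & k j = 0%N) \/
    (forall j, (1 <= j <= N)%N -> (k j <= 1)%N /\ j \in stfK N M) ->
  prime_frame (tetris R N M k xpredT xpredT).
Proof.
move=> hN h2 hL hk hz; split; first exact: tight_tetris_sub hL hk.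
case/proper_tightP=> S [/subseq_tetris[k' [c [d [hk' ->]]]] hS].
case/(tight_tetris_pairs hN h2) => A A0 hA.
suff E : tetris R N M k' c d = tetris R N M k xpredT xpredT.
  by rewrite E ltnn in hS.
(* Without pairs [m_j = lambda], so the second alternative also reduces to [k' j = A]. *)
have hA1 : (forall j, (1 <= j <= N)%N -> j \in stfK N M) ->
    forall j, (1 <= j <= N)%N -> (k' j)%:R = A.
  move=> allK j hj; case: hA => [[h _]|[h _]]; first exact: h.
  have := h j hj; have := tetris_diag_full hN h2 hj.
  have jK : j.-1 \in stfK N M.
    case: j hj => // -[|j] hj; first exact: mem0_stfK.
    by apply: allK; apply: ltnW.
  rewrite /tetris_diag /pair_cnt allK // jK; lra.
(* Row [i] excludes the first alternative because [A > 0]; in the second it gives [A = lambda - L],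
   whence [k' = k]. *)
case: hz => [[i hi ki]|hz].
  have k'i : k' i = 0%N by apply/eqP; rewrite -leqn0 -ki hk'.
  case: hA => [[h _]|[h hcd]].
    by have := h i hi; rewrite k'i => E; rewrite -E ltxx in A0.
  apply: eq_tetris => j hj; last by move=> jK; have /andP[-> ->] := hcd j hj jK.
  apply/eqP; rewrite -(@eqr_nat R); apply/eqP.
  have := h j hj; have := h i hi; rewrite k'i -!hk // ki !natrD; lra.
apply: eq_tetris => j hj; last first.
  have hj' : (1 <= j <= N)%N by lia.
  by have [_ ->] := hz j hj'.
have := hA1 (fun i hi => proj2 (hz i hi)) j hj; have [kj _] := hz j hj.
have := hk' j hj; case: (k' j) => [_ E|n]; last by lia.
by rewrite -E ltxx in A0.
Qed.

(** * The divisibility criterion *)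

Lemma stf_m_gt0 (R : realType) (N M j : nat) : (0 < N)%N ->
    2 <= M%:R / N%:R :> R -> (j < N)%N ->
  (0 < stf_m R N M j.+1)%N = (j \in stfK N M) || (3 + j * M %/ N <= j.+1 * M %/ N)%N.
Proof.
move=> hN h2 hj; have [_ E] := stf_closed_form hN h2 hj.
have M2N := h2; rewrite ratio_ge2 // in M2N.
have le_fl : (j * M %/ N + 2 <= j.+1 * M %/ N)%N.
  by rewrite leq_divRL // mulnDl mulSn addnC leq_add // leq_trunc_div.
by move: E; case: (_ \in _) => /=; lia.
Qed.

(** If some [m_j] vanishes, primality with [L = 0] applies; otherwise omitting one copy of each
    [e_j] leaves a proper tight subcollection with constant [lambda - 1]. *)
Lemma divisible_STF (R : realType) (N M : nat) : (0 < N)%N ->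
    2 <= M%:R / N%:R :> R ->
  divisible_frame (STF R N M) <->
  (forall j, (1 <= j <= N)%N -> (0 < stf_m R N M j)%N).
Proof.
move=> hN h2; rewrite STF_tetris; split=> [[_ hdiv] j hj|hm].
  rewrite lt0n; apply/eqP => m0.
  have [|||_ []//] := @prime_tetris R N M 0 (stf_m R N M) hN h2.
  - by apply: lt_le_trans h2.
  - by move=> i _; rewrite addn0.
  - by left; exists j.
have tight L k := @tight_tetris_sub R N M L k hN h2.
split; first by apply: (tight 0%N) => [|j _]; [apply: lt_le_trans h2|rewrite addn0].
have hk j : (1 <= j <= N)%N -> ((stf_m R N M j).-1 + 1)%N = stf_m R N M j.
  by move=> hj; rewrite addn1 prednK // hm.
apply/proper_tightP; exists (tetris R N M (fun j => (stf_m R N M j).-1) xpredT xpredT).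
split; last by apply: (tight 1%N) => //; apply: lt_le_trans h2; rewrite ltr1n.
  by apply: tetris_subseq => j; apply: leq_pred.
rewrite (perm_size (perm_tetris_basis _ _ _ _ hk)) [ltnRHS]size_cat.
by rewrite -[ltnLHS]addn0 ltn_add2l /= cats0 size_map size_iota.
Qed.

(* The increments of [floor (j lambda)] are periodic with period [q = N / gcd],
   so only the rows [1 < j <= q] matter; in row [q] the increment is the ceiling
   of the non-integer [lambda], hence at least [3]. *)
Lemma stf_m_gt0_period (R : realType) (N M : nat) : (0 < N)%N ->
    2 <= M%:R / N%:R :> R ->
  (forall j, (1 <= j <= N)%N -> (0 < stf_m R N M j)%N) <->
  (forall j, (0 < j)%N -> (j.+1 < N %/ gcdn N M)%N ->
     3 + j * M %/ N <= j.+1 * M %/ N)%N.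
Proof.
move=> hN h2; have g0 : (0 < gcdn N M)%N by rewrite gcdn_gt0 hN.
have M2N := h2; rewrite ratio_ge2 // in M2N.
have q0 : (0 < N %/ gcdn N M)%N by rewrite divn_gt0 // dvdn_leq // dvdn_gcdl.
have memK j : (j <= N)%N -> (j \in stfK N M) = (N %/ gcdn N M %| j)%N.
  by move=> hj; rewrite mem_stfK // dvdn_mul_gcd.
have qM : (N %/ gcdn N M * M = M %/ gcdn N M * N)%N.
  by rewrite divn_mulAC ?dvdn_gcdl // mulnC -divn_mulAC ?dvdn_gcdr.
set q := (N %/ _)%N in q0 memK qM *; have qN : (q <= N)%N by apply: leq_div.
split=> [hm j j0 jq|hc [|j] //= jN].
  have jN : (j < N)%N by lia.
  have := hm j.+1 jN; rewrite stf_m_gt0 // memK ?(ltnW jN) //.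
  by rewrite gtnNdvd // ltnW.
rewrite stf_m_gt0 // memK ?(ltnW jN) //; case: (boolP (_ %| _)%N) => //= qj.
pose i := (j %% q)%N; have i0 : (0 < i)%N by rewrite lt0n.
have iq : (i < q)%N by rewrite ltn_pmod.
have [iq1|] := ltnP i.+1 q.
  (* [q * lambda] is the integer [M / gcd], so each period shifts the floors by that integer. *)
  have shift a : ((j %/ q * q + a) * M %/ N = j %/ q * (M %/ gcdn N M) + a * M %/ N)%N.
    by rewrite mulnDl -mulnA qM mulnA divnMDl.
  rewrite (divn_eq j q) -/i -addnS !shift; have := hc i i0 iq1; lia.
(* Now [(j + 1) * lambda] is an integer [a] while [j * lambda] is not, so [a] exceeds the floor [b]
   of the latter by more than [lambda >= 2]. *)
move=> qi; have Ei : i.+1 = q by lia.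
have /dvdnP[a Ea] : (N %| j.+1 * M)%N.
  by rewrite dvdn_mul_gcd // -/q (divn_eq j q) -/i -addnS Ei addnC -mulSn dvdn_mull.
have Eb := divn_eq (j * M) N.
have s0 : (0 < j * M %% N)%N by rewrite lt0n -/(dvdn _ _) dvdn_mul_gcd.
rewrite Ea mulnK //; set b := (_ %/ _)%N in Eb *.
have : (b * N + 2 * N < a * N)%N by rewrite -Ea (mulSn j) {1}Eb; lia.
by rewrite -mulnDl ltn_mul2r hN /=; lia.
Qed.

(** The integer [3 + floor (j * lambda)] is at most a real number exactly when it is at most its
    floor. *)
Lemma floor_cond (R : realType) (N M j : nat) : (0 < N)%N ->
  (3 <= j.+1%:R * (M%:R / N%:R) -
     (Num.floor ((j.+1%:R - 1) * (M%:R / N%:R) : R))%:~R :> R) =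
  (3 + j * M %/ N <= j.+1 * M %/ N)%N.
Proof.
move=> hN; have n0 : 0 < N%:R :> R by rewrite ltr0n.
have -> : Num.floor ((j.+1%:R - 1) * (M%:R / N%:R) : R) = (j * M %/ N)%N%:Z.
  apply: floor_def; rewrite -natr1 addrK mulrA -natrM.
  have -> : (j * M %/ N)%N%:Z + 1 = (j * M %/ N).+1%:Z by lia.
  rewrite -!pmulrn ler_pdivlMr // ltr_pdivrMr // -!natrM ler_nat ltr_nat.
  by rewrite leq_trunc_div ltn_ceil.
rewrite -pmulrn lerBrDr mulrA -natrM -natrD ler_pdivlMr // -natrM ler_nat.
by rewrite -leq_divRL.
Qed.

(** * Factorization and final criterion *)

Theorem theorem3p9 (R : realType) (N M : nat)
    (hN : (0 < N)%N) (hM : (0 < M)%N) (hlambda : 2 <= M%:R / N%:R :> R) :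
  let lambda : R := M%:R / N%:R in
  let Phi : seq 'rV[R]_N := STF R N M in
  [/\ prime_frame Phi \/
        (exists (L : nat) (Phi1 : seq 'rV[R]_N),
          [/\ (0 < L)%N, FUNTF Phi1, prime_frame Phi1,
              (size Phi1 + L * N = M)%N &
              perm_eq Phi (Phi1 ++ flatten (nseq L (stdbasis R N)))]),
      divisible_frame Phi <->
        (forall j : nat, (1 < j)%N -> j%:R < N%:R / (gcdn N M)%:R :> R ->
          3 <= j%:R * lambda - (Num.floor ((j%:R - 1) * lambda))%:~R),
      3 - 1 / N%:R <= lambda -> divisible_frame Phi &
      3 - 1 / N%:R <= lambda <-> (3 * N - 1 <= M)%N].
Proof.
move=> lambda Phi; have n0 : 0 < N%:R :> R by rewrite ltr0n.
have lam3 : 3 - 1 / N%:R <= lambda <-> (3 * N - 1 <= M)%N.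
  rewrite -(ler_pM2r n0) /lambda mulrBl !divfK ?gt_eqF // lerBlDr -natrM.
  by rewrite natr1 ler_nat leq_subLR add1n.
split=> //.
- have M2N := hlambda; rewrite ratio_ge2 // in M2N.
  (* [L] is the minimum of the [m_j], except for integer [lambda]: there the minimum would leave
     nothing, so one copy of the basis is kept. *)
  have [L [L0 hL hmin]] : exists L : nat,
      [/\ L%:R < lambda, forall j, (1 <= j <= N)%N -> (L <= stf_m R N M j)%N &
      (exists2 j, (1 <= j <= N)%N & (stf_m R N M j - L = 0)%N) \/
      (forall j, (1 <= j <= N)%N -> (stf_m R N M j - L <= 1)%N /\ j \in stfK N M)].
    have [NM|NM] := boolP (N %| M)%N.
      have allK j : (j <= N)%N -> j \in stfK N M.
        by move=> jN; rewrite mem_stfK // dvdn_mull.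
      have mE j : (1 <= j <= N)%N -> stf_m R N M j = (M %/ N)%N.
        case: j => // j hj; have [_] := stf_closed_form hN hlambda hj.
        by rewrite allK ?(ltnW hj) // (mulSn j) divnDl //; lia.
      have MN2 : (2 <= M %/ N)%N by rewrite leq_divRL.
      exists (M %/ N).-1; split.
      + by rewrite /lambda ltr_pdivlMr // -natrM ltr_nat -{2}(divnK NM) ltn_pmul2r //; lia.
      + by move=> j /mE ->; apply: leq_pred.
      + by right=> j hj; rewrite mE //; split; [lia|apply: allK; case/andP: hj].
    have [i _ imin] := arg_minnP (fun i : 'I_N => stf_m R N M i.+1)
      (erefl : xpredT (Ordinal hN)).
    exists (stf_m R N M i.+1); split.
    (* The minimum is at most [m_1 = lambda - r_1], and [r_1 > 0] because [N] does not divide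
       [M]. *)
    + have := imin (Ordinal hN) isT; rewrite /= -(ler_nat R) => /le_lt_trans; apply.
      have [/andP[r0 _]] := stfP hlambda (j := 1%N) hN.
      rewrite mem0_stfK -/lambda => ->; rewrite ltrDl lt_def r0 andbT.
      by rewrite stf_r_eq0 // mem_stfK // mul1n.
    + by case=> // j hj; apply: (imin (Ordinal hj)).
    + by left; exists i.+1; [exact: ltn_ord|rewrite subnn].
  pose k j := (stf_m R N M j - L)%N.
  have hk j : (1 <= j <= N)%N -> (k j + L)%N = stf_m R N M j.
    by move=> hj; rewrite subnK // hL.
  have pr : prime_frame (tetris R N M k xpredT xpredT).
    exact: prime_tetris L0 hk hmin.
  have pe := perm_tetris_basis R M xpredT xpredT hk.
  case: (posnP L) => [E|Lpos].
    left; suff -> : Phi = tetris R N M k xpredT xpredT by [].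
    by rewrite /Phi STF_tetris; apply: eq_tetris => // j _; rewrite /k E subn0.
  right; exists L, (tetris R N M k xpredT xpredT); split=> //.
    by split; [case: pr|move=> phi; apply: norm2_tetris].
  rewrite -[RHS](size_tetris_stf hN hlambda) (perm_size pe) [RHS]size_cat; congr addn.
  by rewrite [in RHS]size_flatten /shape map_nseq sumn_nseq size_map size_iota mulnC.
- rewrite divisible_STF // stf_m_gt0_period //.
  have g0 : (0 < gcdn N M)%N by rewrite gcdn_gt0 hN.
  have lt_q j : (j%:R < N%:R / (gcdn N M)%:R :> R) = (j < N %/ gcdn N M)%N.
    rewrite ltr_pdivlMr ?ltr0n // -natrM ltr_nat.
    by rewrite -[X in (_ < X)%N = _](divnK (dvdn_gcdl N M)) ltn_pmul2r.
  split=> [h [|j] // j1|h j j0 jq]; first by rewrite lt_q floor_cond //; apply: h.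
  by rewrite -(floor_cond R) //; apply: h; rewrite ?lt_q.
- move=> /lam3 h; apply/divisible_STF => // -[|j] //= jN; rewrite stf_m_gt0 //.
  rewrite mem_stfK ?(ltnW jN) // /dvdn; case: eqP => //= /eqP; rewrite -lt0n => s0.
  (* Off [K] the remainder [s] of [j * M] modulo [N] is positive and supplies the unit by which [M]
     may fall short of [3 * N]. *)
  rewrite leq_divRL // mulnDl (mulSn j).
  by have := divn_eq (j * M) N; move: (_ %/ _)%N (_ %% _)%N s0 => b s; lia.
Qed.
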